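(* Let $1<p<\infty$, let $q=p/(p-1)$, and let $\omega=\{\omega_k\}_{k\in\mathbb N}$ be an admissible weight. Let $f$ be a polynomial of degree $d\in\mathbb N$ with simple zeros only, with zero set $Z(f)=\{z_1,\dots,z_d\}\subset\mathbb T$. Let $(p_n)_{n\in\mathbb N}$ be the sequence of optimal polynomial approximants to $1/f$ in $\ell^p_A(\omega)$, and put $d_{t,n}=\big(\widehat{1-p_nf}(t)\big)^{<p-1>}\omega_t$. Then, for all $n\in\mathbb N$ and $0\le t\le n+d$, $$d_{t,n}=\sum_{i=1}^dA_{i,n}z_i^t,$$ where the complex constants $A_{1,n},\dots,A_{d,n}$ are the only solution to the nonlinear system $$1=\sum_{t=0}^{n+d}\left(\sum_{i=1}^dA_{i,n}\frac{z_i^t}{\omega_t}\right)^{<q-1>}z_l^t,\qquad 1\le l\le d.$$ Moreover, $$\|1-p_nf\|_{p,\omega}^p=\sum_{i=1}^dA_{i,n}.$$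
   Context: $\mathbb N$ denotes the non-negative integers, $\mathbb D$ the open unit disc of $\mathbb C$ and $\mathbb T$ the unit circle. Admissible weight: a sequence $\omega=\{\omega_k\}_{k\in\mathbb N}$ of positive real numbers with $\omega_0=1$, $\lim_{k\to\infty}\omega_{k+1}/\omega_k=1$, and such that there is a constant $C>0$ with $C^{-1}\omega_k\le\omega_{k+t}\le C\omega_k$ for all $t,k\in\mathbb N$ with $0\le t\le k+1$. For $1\le p<\infty$, $\ell^p_A(\omega)$ is the space of analytic functions $g(z)=\sum_{k\in\mathbb N}a_kz^k$ on $\mathbb D$ with finite norm $\|g\|_{p,\omega}=\big(\sum_{k=0}^\infty|a_k|^p\omega_k\big)^{1/p}$. $\mathcal P_n$ is the space of polynomials of degree at most $n$. For $f\in\ell^p_A(\omega)$ and $n\in\mathbb N$, $p_n\in\mathcal P_n$ is an optimal polynomial approximant (of order $n$) to $1/f$ in $\ell^p_A(\omega)$ if $\|1-p_nf\|_{p,\omega}=\inf_{P\in\mathcal P_n}\|1-Pf\|_{p,\omega}$. For $1<p<\infty$ and $f\not\equiv0$ it exists and is unique. $\hat g(k)$ denotes the Taylor coefficient of order $k$ of $g$ around $0$. For $z=re^{i\theta}$ with $r>0$ and $s\ge0$, $z^{<s>}:=r^se^{-i\theta}$; and $0^{<s>}:=0$. *)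

(* Defs.v *)
From HB Require Import structures.
From mathcomp Require Import all_boot all_order all_algebra.
From mathcomp Require Import all_classical all_reals all_analysis.
From mathcomp Require Import complex.

Set Implicit Arguments.
Unset Strict Implicit.
Unset Printing Implicit Defensive.

Import Order.TTheory GRing.Theory Num.Theory.
Import numFieldNormedType.Exports.
Import ComplexField.Normc.

Local Open Scope classical_set_scope.
Local Open Scope ring_scope.
Local Open Scope complex_scope.

Definition admissible_weight (R : realType) (w : nat -> R) : Prop :=
  [/\ forall k, 0 < w k,
      w 0%N = 1,
      (fun k => w k.+1 / w k) @ \oo --> (1 : R)
    & exists2 C : R, 0 < C &
        forall t k : nat, (t <= k.+1)%N ->
          C^-1 * w k <= w (k + t)%N <= C * w k].

(* An analytic function on the unit disc is represented by the sequence [a] of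
   its Taylor coefficients at 0. *)
Definition analytic_on_disc (R : realType) (a : nat -> R[i]) : Prop :=
  forall z : R[i], `|z| < 1 ->
    cvgn (series (fun k => a k * z ^+ k) : nat -> (R[i])^o).

Definition lpA_enorm (R : realType) (p : R) (w : nat -> R) (a : nat -> R[i])
    : \bar R :=
  ((\sum_(0 <= k <oo) (normc (a k) `^ p * w k)%:E) `^ p^-1)%E.

Definition lpA (R : realType) (p : R) (w : nat -> R) : set (nat -> R[i]) :=
  [set a | analytic_on_disc a /\ (lpA_enorm p w a < +oo)%E].

Definition lpA_norm (R : realType) (p : R) (w : nat -> R) (a : nat -> R[i])
    : R :=
  fine (lpA_enorm p w a).

(* Taylor coefficients of 1 - P f. *)
Definition opa_residual (R : realType) (P : {poly R[i]}) (f : nat -> R[i])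
    (k : nat) : R[i] :=
  (k == 0%N)%:R - \sum_(j < k.+1) P`_j * f (k - j)%N.

Definition is_opa (R : realType) (p : R) (w : nat -> R) (f : nat -> R[i])
    (n : nat) (P : {poly R[i]}) : Prop :=
  [/\ lpA p w f,
      (size P <= n.+1)%N
    & lpA_norm p w (opa_residual P f) =
      inf [set lpA_norm p w (opa_residual Q f) |
            Q in [set Q : {poly R[i]} | (size Q <= n.+1)%N]]].

(* z^<s>: for z = r e^(i theta) with r > 0, e^(- i theta) is the conjugate of
   z / r; see [anglepow_polar]. *)
Definition anglepow (R : realType) (z : R[i]) (s : R) : R[i] :=
  if z == 0 then 0 else (normc z `^ s)%:C * (z / (normc z)%:C)^*.

Lemma anglepow_polar (R : realType) (r theta s : R) : 0 < r ->
  anglepow (r%:C * (cos theta +i* sin theta)) s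
  = (r `^ s)%:C * (cos theta -i* sin theta).
Proof.
move=> r0; have nE : normc (r%:C * (cos theta +i* sin theta)) = r.
  rewrite normcM /= expr0n addr0 cos2Dsin2 sqrtr1 mulr1 sqrtr_sqr.
  by rewrite gtr0_norm.
have rC0 : r%:C != 0 by rewrite eq_complex /= eqxx andbT gt_eqF.
rewrite /anglepow nE mulrAC divff // mul1r ifF //.
apply/negP => /eqP z0; move: nE; rewrite z0 normc0 => r0'.
by move: r0; rewrite -r0' ltxx.
Qed.

Lemma opa_residual_poly (R : realType) (P f : {poly R[i]}) (k : nat) :
  opa_residual P (fun j => f`_j) k = (1 - P * f)`_k.
Proof. by rewrite coefB coef1 coefM. Qed.

Lemma lpA_poly (R : realType) (p : R) (w : nat -> R) (f : {poly R[i]}) :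
  0 < p -> (forall k, 0 < w k) -> lpA p w (fun k => f`_k).
Proof.
move=> p0 w0; have f0 k : (size f <= k)%N -> f`_k = 0 by exact: nth_default.
split=> [z _|].
  rewrite -(is_cvg_series_restrict (size f)).
  rewrite (_ : (fun _ => _) = (fun=> 0 : (R[i])^o)); first exact: is_cvg_cst.
  apply/funext => m; rewrite big_nat_cond big1 // => k /andP[/andP[fk _] _].
  by rewrite f0 // mul0r.
rewrite /lpA_enorm; apply: poweR_lty.
rewrite (nneseries_split _ (size f)); last first.
  by move=> k _; rewrite lee_fin mulr_ge0 ?powR_ge0 // ltW.
rewrite [X in (_ + X)%E]eseries0 ?adde0; first by rewrite sumEFin ltry.
by move=> k fk _; rewrite f0 // normc0 powR0 ?mul0r // gt_eqF.
Qed.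

(* Main.v *)
(** Put N = n + d and g = 1 - p_n f.  The first-order condition for the minimum
    says that D_t = g_t^<p-1> w_t annihilates f * P_n.  The sequences on
    0, ..., N annihilating f * P_n are the combinations of the d power sequences
    z_i^t.  Since <q-1> inverts <p-1>, the system for A expresses g(z_l) = 1,
    and pairing D with g gives the norm.  Two solutions of the system give
    coefficient sequences g, h with equal values at the z_l, so the pairing of
    g^<p-1> - h^<p-1> (weighted) with g - h vanishes; strict monotonicity of
    x |-> |x|^(p-2) conj x then forces g = h, and Vandermonde gives A = B. *)

Require Import Defs.
From mathcomp Require Import all_boot all_order all_algebra.
From mathcomp Require Import all_classical all_reals all_analysis.
From mathcomp Require Import complex ring lra.

Set Implicit Arguments.
Unset Strict Implicit.
Unset Printing Implicit Defensive.

Import Order.TTheory GRing.Theory Num.Theory.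
Import numFieldNormedType.Exports.

Local Open Scope classical_set_scope.
Local Open Scope ring_scope.
Local Open Scope complex_scope.

Local Notation normc := ComplexField.Normc.normc.

(** * Moduli and the operation [z^<s>] on complex numbers *)

Section ComplexFacts.
Variable R : realType.
Implicit Types (x y : R[i]) (k e s : R).

Lemma conjcM x y : conjc (x * y) = conjc x * conjc y.
Proof. exact: rmorphM. Qed.

Lemma realCM k e : (k * e)%:C = k%:C * e%:C.
Proof. exact: rmorphM. Qed.

Lemma normc_ge0 x : 0 <= normc x.
Proof. by case: x => a b; exact: sqrtr_ge0. Qed.

Lemma normc_eq0 x : (normc x == 0) = (x == 0).
Proof.
apply/eqP/eqP => [/ComplexField.Normc.eq0_normc //|->].
exact: ComplexField.Normc.normc0.
Qed.

Lemma normc_gt0 x : (0 < normc x) = (x != 0).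
Proof. by rewrite lt_def normc_eq0 normc_ge0 andbT. Qed.

Lemma normc_real k : 0 <= k -> normc k%:C = k.
Proof. by move=> k0; rewrite /= expr0n addr0 sqrtr_sqr ger0_norm. Qed.

Lemma normc_conj x : normc (conjc x) = normc x.
Proof. by case: x => a b; rewrite /= sqrrN. Qed.

Lemma sqr_normc_Re_Im x : normc x ^+ 2 = complex.Re x ^+ 2 + complex.Im x ^+ 2.
Proof. by case: x => a b; rewrite /= sqr_sqrtr // addr_ge0 ?sqr_ge0. Qed.

Lemma conjc_mul_self x : conjc x * x = (normc x ^+ 2)%:C.
Proof.
rewrite sqr_normc_Re_Im; case: x => a b; apply/eqP.
by rewrite eq_complex /=; apply/andP; split; apply/eqP; ring.
Qed.

Lemma Re_realM k x : complex.Re (k%:C * x) = k * complex.Re x.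
Proof. by case: x => a b /=; rewrite mul0r subr0. Qed.

Lemma Im_realM k x : complex.Im (k%:C * x) = k * complex.Im x.
Proof. by case: x => a b /=; rewrite mul0r addr0. Qed.

Lemma normcE x : normc x = Num.sqrt (complex.Re x ^+ 2 + complex.Im x ^+ 2).
Proof. by case: x. Qed.

Lemma Re_conjcM x y : complex.Re (conjc x * y)
  = complex.Re x * complex.Re y + complex.Im x * complex.Im y.
Proof. by case: x y => [a b] [a' b'] /=; rewrite mulNr opprK. Qed.

Lemma Re_le_normc x : complex.Re x <= normc x.
Proof.
case: x => a b /=; apply: (le_trans (ler_norm a)).
by rewrite -sqrtr_sqr ler_wsqrtr // lerDl sqr_ge0.
Qed.

(** Removes the case split at 0: there the factor [conjc x] vanishes, whatever the real factor
    is. *)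
Lemma anglepowE x s : anglepow x s = (normc x `^ s / normc x)%:C * conjc x.
Proof.
rewrite /anglepow; have [->|x0] := eqVneq x 0; first by rewrite raddf0 mulr0.
have n0 : (normc x)%:C != 0 by rewrite eq_complex /= eqxx andbT normc_eq0.
rewrite -[Num.conj _]/(conjc _) conjcM conjc_inv conjc_real realCM fmorphV.
by rewrite mulrA mulrAC.
Qed.

Lemma normc_anglepow x s : s != 0 -> normc (anglepow x s) = normc x `^ s.
Proof.
move=> s0; have [->|x0] := eqVneq x 0.
  by rewrite /anglepow eqxx ComplexField.Normc.normc0 powR0.
rewrite anglepowE ComplexField.Normc.normcM normc_conj normc_real.
  by rewrite mulfVK // normc_eq0.
by rewrite divr_ge0 ?powR_ge0 ?normc_ge0.
Qed.

Lemma anglepowM_self x s : 0 < s ->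
  anglepow x s * x = (normc x `^ (s + 1))%:C.
Proof.
move=> s0; have s1 : s + 1 != 0 by rewrite gt_eqF // addr_gt0.
have [->|x0] := eqVneq x 0.
  by rewrite mulr0 ComplexField.Normc.normc0 powR0.
rewrite anglepowE -mulrA conjc_mul_self -realCM; congr (_%:C).
rewrite powRD ?(negPf s1) // powRr1 ?normc_ge0 //.
by rewrite expr2 mulrA mulfVK // normc_eq0.
Qed.

Lemma anglepowM k x s : 0 < k ->
  anglepow (k%:C * x) s = (k `^ s)%:C * anglepow x s.
Proof.
move=> k0; rewrite !anglepowE conjcM conjc_real.
rewrite ComplexField.Normc.normcM normc_real ?ltW // powRM ?normc_ge0 ?ltW //.
rewrite mulrA mulrA -!realCM; congr (_%:C * _).
rewrite invfM [RHS]mulrA -!mulrA; congr (_ * _); congr (_ * _).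
by rewrite mulrCA mulVf ?mulr1 // gt_eqF.
Qed.

(** The phase is conjugated twice and the modulus becomes |x|^(st) = |x|. The pair (s, t) will be p
    - 1 and q - 1, in either order. *)
Lemma anglepowK s t x : 0 < s -> s * t = 1 ->
  anglepow (anglepow x s) t = x.
Proof.
move=> s0 st; have [->|x0] := eqVneq x 0.
  by rewrite /anglepow eqxx eqxx.
have n0 : 0 < normc x by rewrite normc_gt0.
rewrite (anglepowE _ t) normc_anglepow ?gt_eqF // -powRrM st powRr1 ?normc_ge0 //.
rewrite anglepowE conjcM conjc_real conjcK mulrA -realCM.
rewrite mulrA mulfVK ?gt_eqF ?powR_gt0 // divff ?gt_eqF //.
by rewrite mul1r.
Qed.

(* Young's inequality: |x|^p lies above its tangent at y. *)
Lemma normc_powR_tangent p x y : 1 < p ->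
  normc y `^ p + p * complex.Re (anglepow y (p - 1) * (x - y))
    <= normc x `^ p.
Proof.
move=> p1; have p0 : 0 < p by lra.
have s0 : 0 < p - 1 by lra.
rewrite mulrBr anglepowM_self // subrK raddfB /=.
have Re_le : complex.Re (anglepow y (p - 1) * x)
    <= normc x * normc y `^ (p - 1).
  apply: (le_trans (Re_le_normc _)).
  by rewrite ComplexField.Normc.normcM normc_anglepow ?gt_eqF // mulrC.
(* Young is applied to |x| and |y|^(p-1); the exponent p/(p-1) turns the latter into |y|^p. *)
have pq : p^-1 + (p / (p - 1))^-1 = 1 by field; rewrite !gt_eqF.
have := conjugate_powR (normc_ge0 x) (powR_ge0 (normc y) (p - 1)) p0
  (divr_gt0 p0 s0) pq.
rewrite -powRrM mulrCA divff ?gt_eqF // mulr1 invf_div mulrA => young.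
have {}young : p * (normc x * normc y `^ (p - 1))
    <= normc x `^ p + (p - 1) * normc y `^ p.
  apply: le_trans (ler_wpM2l (ltW p0) young) _.
  by rewrite le_eqVlt; apply/orP; left; apply/eqP; field; rewrite gt_eqF.
have := ler_wpM2l (ltW p0) Re_le; lra.
Qed.

(* The product splits as (|x|^s - |y|^s)(|x| - |y|) plus the defect in
   Cauchy-Schwarz; both parts vanish only for x = y. *)
Lemma anglepow_strict_mono s x y : 0 < s ->
  0 <= complex.Re ((anglepow x s - anglepow y s) * (x - y)) ?= iff (x == y).
Proof.
move=> s0; set X := complex.Re _.
have s1 : s + 1 != 0 by rewrite gt_eqF // addr_gt0.
have Rele a b : complex.Re (anglepow a s * b) <= normc a `^ s * normc b.
  apply: (le_trans (Re_le_normc _)).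
  by rewrite ComplexField.Normc.normcM normc_anglepow ?gt_eqF.
have Reself a : complex.Re (anglepow a s * a) = normc a `^ s * normc a.
  rewrite anglepowM_self //= powRD ?(negPf s1) // powRr1 ?normc_ge0 //.
have XE : X = normc x `^ s * normc x + normc y `^ s * normc y
    - complex.Re (anglepow x s * y) - complex.Re (anglepow y s * x).
  rewrite /X mulrBr !mulrBl !raddfB /= !Reself; ring.
have [xy yx] := (Rele x y, Rele y x).
have XD : (normc x `^ s - normc y `^ s) * (normc x - normc y) <= X.
  by rewrite XE; lra.
have incr a b : a != b -> 0 <= a -> 0 <= b ->
    0 < (a `^ s - b `^ s) * (a - b).
  wlog ab : a b / a < b => [hw|] ne a0 b0.
    case: (ltgtP a b) ne => // [ab|ba] _; first by apply: hw; rewrite ?lt_eqF.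
    by rewrite -mulrNN !opprB; apply: hw; rewrite ?lt_eqF.
  rewrite nmulr_rgt0 subr_lt0 //.
  by apply: gt0_ltr_powR; rewrite ?nnegrE.
have D0 : 0 <= (normc x `^ s - normc y `^ s) * (normc x - normc y).
  have [->|ne] := eqVneq (normc x) (normc y); first by rewrite !subrr mulr0.
  by apply/ltW/incr => //; exact: normc_ge0.
split; first exact: le_trans XD.
apply/eqP/eqP => [X0|eqxy]; last by rewrite /X eqxy !subrr mulr0.
(* Different moduli would make the lower bound in [XD] positive by [incr]. *)
have nxy : normc x = normc y.
  apply/eqP/negPn/negP => ne.
  by have := incr _ _ ne (normc_ge0 _) (normc_ge0 _); lra.
have [x0|x0] := eqVneq x 0.
  by apply/esym/eqP; rewrite x0 -normc_eq0 -nxy normc_eq0 x0.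
have n0 : 0 < normc x by rewrite normc_gt0.
have n2 : 0 < normc x `^ s / normc x by rewrite divr_gt0 ?powR_gt0.
(* With equal moduli, X = 0 forces equality in [xy], hence Re(conj x y) = |x|^2, and expanding |x -
   y|^2 gives 0. *)
have Rexy : complex.Re (anglepow x s * y) = normc x `^ s * normc x.
  by move: XE yx xy; rewrite -X0 -nxy; lra.
have {}Rexy : complex.Re (conjc x * y) = normc x ^+ 2.
  apply: (mulfI (lt0r_neq0 n2)); rewrite -Re_realM mulrA -anglepowE Rexy.
  by rewrite expr2 mulrA mulfVK ?gt_eqF.
apply/eqP; rewrite -subr_eq0 -normc_eq0 -sqrf_eq0; apply/eqP.
have := sqr_normc_Re_Im x; have := sqr_normc_Re_Im y; move: Rexy.
rewrite -nxy !sqr_normc_Re_Im; rewrite Re_conjcM !raddfB /=; lra.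
Qed.

(** Lets the step size tend to 0 in the variational inequality. The point x = 0 is separate because
    |x|^s / |x| need not be continuous there. *)
Lemma cvg_Re_anglepow s x y : 0 < s ->
  complex.Re (anglepow (x - e%:C * y) s * y) @[e --> 0^'+]
    --> complex.Re (anglepow x s * y).
Proof.
move=> s0; have [->|x0] := eqVneq x 0.
  have -> : complex.Re (anglepow 0 s * y) = 0 by rewrite /anglepow eqxx mul0r.
  (* At x = 0, positive homogeneity pulls out e^s, which tends to 0. *)
  have E : {near 0^'+, (fun e => e `^ s * complex.Re (anglepow (- y) s * y)) =1
     (fun e => complex.Re (anglepow (0 - e%:C * y) s * y))}.
    near=> e; have e0 : 0 < e by near: e; exact: nbhs_right_gt.
    by rewrite sub0r -mulrN anglepowM // -mulrA Re_realM.
  apply: cvg_trans; first exact: (near_eq_cvg E).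
  have := cvgMr_tmp (b := complex.Re (anglepow (- y) s * y)) (powR_cvg0 s0).
  by rewrite mul0r; apply.
under eq_fun do rewrite anglepowE -mulrA Re_realM.
rewrite anglepowE -mulrA Re_realM.
have c0 (c d : R) : (c - e * d) @[e --> 0^'+] --> c.
  have := cvgB (cvg_cst c) (cvgMr_tmp (b := d) (cvg_at_right_filter (@cvg_id _ (nbhs (0 : R))))).
  by rewrite mul0r subr0; apply.
have cR : complex.Re (x - e%:C * y) @[e --> 0^'+] --> complex.Re x.
  by under eq_fun do rewrite raddfB /= Re_realM; exact: c0.
have cI : complex.Im (x - e%:C * y) @[e --> 0^'+] --> complex.Im x.
  by under eq_fun do rewrite raddfB /= Im_realM; exact: c0.
have cN : normc (x - e%:C * y) @[e --> 0^'+] --> normc x.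
  under eq_fun do rewrite normcE; rewrite normcE.
  by apply: continuous_cvg; [exact: sqrt_continuous|apply: cvgD; apply: cvgM].
have n0 : 0 < normc x by rewrite normc_gt0.
apply: cvgM.
  apply: cvgM; last by apply: cvgV => //; rewrite gt_eqF.
  (* The modulus stays positive near the limit, so the power is exp(s ln) of it. *)
  have E : {near 0^'+, (fun e => expR (s * ln (normc (x - e%:C * y)))) =1
     (fun e => normc (x - e%:C * y) `^ s)}.
    near=> e; rewrite /powR gt_eqF //; near: e.
    exact: (cvgr_gt _ cN).
  apply: cvg_trans; first exact: (near_eq_cvg E).
  rewrite /powR gt_eqF //; apply: continuous_cvg; first exact: continuous_expR.
  apply: cvgM; first exact: cvg_cst.
  by apply: continuous_cvg => //; exact: continuous_ln.
under eq_fun do rewrite Re_conjcM; rewrite Re_conjcM.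
by apply: cvgD; apply: cvgMr_tmp.
Unshelve. all: by end_near.
Qed.
End ComplexFacts.

(** * Power sums at distinct nodes *)

Section Vandermonde.
Variables (F : fieldType) (d : nat) (z : 'I_d -> F).
Hypothesis z_inj : injective z.

Lemma Vandermonde_unit : Vandermonde d (\row_i z i) \in unitmx.
Proof.
rewrite unitmxE det_Vandermonde unitfE; apply/prodf_neq0 => i _.
apply/prodf_neq0 => j ij; rewrite !mxE subr_eq0; apply/eqP => /z_inj ji.
by rewrite ji ltnn in ij.
Qed.

(** The coefficients solve a square Vandermonde system, invertible because the nodes are
    distinct. *)
Lemma power_sums_interpolate (D : nat -> F) :
  exists A : 'I_d -> F,
    forall t, (t < d)%N -> D t = \sum_(i < d) A i * z i ^+ t.
Proof.
pose V := Vandermonde d (\row_i z i).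
pose A := invmx V *m (\col_(t < d) D t).
exists (fun i => A i ord0) => t td.
have /matrixP/(_ (Ordinal td) ord0) : V *m A = \col_(t < d) D t.
  by rewrite mulKVmx ?Vandermonde_unit.
by rewrite !mxE /= => <-; apply: eq_bigr => i _; rewrite [V _ _]mxE mxE mulrC.
Qed.

Lemma power_sums_inj (A B : 'I_d -> F) :
  (forall t, (t < d)%N ->
    \sum_(i < d) A i * z i ^+ t = \sum_(i < d) B i * z i ^+ t) ->
  A =1 B.
Proof.
move=> AB; pose V := Vandermonde d (\row_i z i).
have : V *m (\col_i A i) = V *m (\col_i B i).
  apply/colP => t; rewrite !mxE.
  have := AB t (ltn_ord t).
  under eq_bigr do rewrite mulrC; under [in RHS]eq_bigr do rewrite mulrC.
  by move=> h; under eq_bigr do rewrite !mxE;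
     under [in RHS]eq_bigr do rewrite !mxE.
move/(can_inj (mulKmx Vandermonde_unit))/colP => E i.
by have := E i; rewrite !mxE.
Qed.

(* Subtracting the power sum that agrees with D for t < d, the equation for k
   reduces to (lead_coef f) * (D - power sum)_(k+d) = 0. *)
Lemma annihilator_power_sums (f : {poly F}) (n : nat) (D : nat -> F) :
  size f = d.+1 -> (forall i, root f (z i)) ->
  (forall k, (k <= n)%N ->
     \sum_(t < (n + d).+1) D t * ('X^k * f)`_t = 0) ->
  exists A : 'I_d -> F,
    forall t, (t <= n + d)%N -> D t = \sum_(i < d) A i * z i ^+ t.
Proof.
move=> fd fz Dann; have [A DA] := power_sums_interpolate D.
have size_le k : (k <= n)%N -> (size ('X^k * f)%R <= (n + d).+1)%N.
  move=> kn; apply: (leq_trans (size_polyMleq _ _)).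
  by rewrite size_polyXn fd addSn addnS ltnS leq_add2r.
exists A; elim/ltn_ind => t IH tnd.
case: (ltnP t d) => [td|dt]; first exact: DA.
pose E s := D s - \sum_(i < d) A i * z i ^+ s.
have kn : (t - d <= n)%N by rewrite leq_subLR addnC.
(* Pairing the powers of z_i with X^k f evaluates X^k f at z_i, a root; so the power sum is
   annihilated along with D. *)
have : \sum_(s < (n + d).+1) E s * ('X^(t - d) * f)`_s = 0.
  under eq_bigr do rewrite mulrBl mulr_suml.
  rewrite sumrB Dann // sub0r exchange_big big1 ?oppr0 //= => i _.
  under eq_bigr do rewrite -mulrA [z i ^+ _ * _]mulrC.
  rewrite -mulr_sumr -horner_coef_wide ?size_le // hornerM.
  by move/eqP: (fz i) => ->; rewrite !mulr0.
have tN : (t < (n + d).+1)%N by [].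
(* Only s = t survives: for s < t the induction hypothesis gives E s = 0, and for s > t the index
   exceeds the degree t of X^(t-d) f. *)
rewrite (bigD1 (Ordinal tN)) //= big1 => [|s /eqP st].
  rewrite addr0 coefXnM ltnNge leq_subr /= subKn // => /eqP.
  rewrite mulf_eq0 -[f`__]/(f`_d.+1.-1) -fd -lead_coefE lead_coef_eq0.
  by rewrite -size_poly_eq0 fd orbF subr_eq0 => /eqP.
have [s_lt|s_gt|s_eq] := ltngtP (s : nat) t; last by case: st; exact: val_inj.
  by rewrite /E -IH ?subrr ?mul0r // (leq_trans (ltnW s_lt)).
rewrite coefXnM; case: ltnP => [_|ks]; first by rewrite mulr0.
by rewrite [f`__]nth_default ?mulr0 // fd ltn_subRL subnK.
Qed.
End Vandermonde.

(** * The weighted norm of polynomials, its minimizers and the dual pairing *)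

Section WeightedNorm.
Variables (R : realType) (p : R) (w : nat -> R).
Hypothesis w_gt0 : forall k, 0 < w k.

Lemma lpA_norm_ge0 a : 0 <= lpA_norm p w a.
Proof. by apply/fine_ge0/poweR_ge0. Qed.

Lemma lpA_norm_powR_poly (g : {poly R[i]}) (N : nat) : 0 < p ->
  (size g <= N)%N ->
  lpA_norm p w (fun k => g`_k) `^ p = \sum_(t < N) normc g`_t `^ p * w t.
Proof.
move=> p0 gN; have w0 k : 0 <= w k by exact: ltW.
rewrite /lpA_norm /lpA_enorm (nneseries_split _ N); last first.
  by move=> k _; rewrite lee_fin mulr_ge0 ?powR_ge0.
rewrite [X in (_ + X)%E]eseries0 ?adde0; last first.
  move=> k Nk _; rewrite nth_default ?(leq_trans gN) //.
  by rewrite ComplexField.Normc.normc0 powR0 ?mul0r // gt_eqF.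
rewrite sumEFin poweR_EFin /= -powRrM mulVf ?gt_eqF // powRr1 ?add0n ?big_mkord //.
by apply: sumr_ge0 => k _; rewrite mulr_ge0 ?powR_ge0.
Qed.

(** The real infimum is a genuine lower bound because the norms are bounded below by 0. *)
Lemma is_opa_min (f P Q : {poly R[i]}) (n : nat) :
  is_opa p w (fun k => f`_k) n P -> (size Q <= n.+1)%N ->
  lpA_norm p w (fun k => (1 - P * f)`_k)
    <= lpA_norm p w (fun k => (1 - Q * f)`_k).
Proof.
move=> [_ _ Pinf] sQ.
have resE (S : {poly R[i]}) :
    opa_residual S (fun k => f`_k) = (fun k => (1 - S * f)`_k).
  by apply/funext => k; exact: opa_residual_poly.
rewrite -!resE Pinf; apply: ge_inf; last by exists Q.
by exists 0 => _ [S _ <-]; exact: lpA_norm_ge0.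
Qed.

(* The tangent inequality at g - e h gives the bound with g - e h in place
   of g, for every e > 0; then let e tend to 0. *)
Lemma minimizer_variation (N : nat) (g h : nat -> R[i]) : 1 < p ->
  (forall e, 0 < e ->
    \sum_(t < N) normc (g t) `^ p * w t
      <= \sum_(t < N) normc (g t - e%:C * h t) `^ p * w t) ->
  \sum_(t < N) complex.Re (anglepow (g t) (p - 1) * h t) * w t <= 0.
Proof.
move=> p1 gmin; have s0 : 0 < p - 1 by rewrite subr_gt0.
have cvgS : \sum_(t < N)
      complex.Re (anglepow (g t - e%:C * h t) (p - 1) * h t) * w t @[e --> 0^'+]
    --> \sum_(t < N) complex.Re (anglepow (g t) (p - 1) * h t) * w t.
  apply: cvg_big => [|t _]; first exact: add_continuous.
  by apply: cvgMr_tmp; exact: cvg_Re_anglepow.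
apply: (ler_cvg_to cvgS (cvg_cst 0)); near=> e.
have e0 : 0 < e by near: e; exact: nbhs_right_gt.
(* The tangent at g - e h, evaluated at g, has increment e h, whence the factor p e to be divided
   out. *)
have pe0 : 0 < p * e by rewrite mulr_gt0 // (lt_trans ltr01).
rewrite -(pmulr_rle0 _ pe0) mulr_sumr.
have : \sum_(t < N) (normc (g t) `^ p * w t
    - normc (g t - e%:C * h t) `^ p * w t) <= 0.
  by rewrite sumrB subr_le0 gmin.
apply: le_trans.
apply: ler_sum => t _; rewrite -mulrBl mulrA ler_pM2r ?w_gt0 //.
have := normc_powR_tangent (g t) (g t - e%:C * h t) p1.
by rewrite subKr mulrCA Re_realM [_ * (e * _)]mulrA lerBrDl.
Unshelve. all: by end_near.
Qed.

(* Monotonicity of x |-> |x|^(s-1) conj x makes every term nonnegative. *)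
Lemma anglepow_pairing_inj (s : R) (N : nat) (g h : nat -> R[i]) : 0 < s ->
  \sum_(t < N) (anglepow (g t) s - anglepow (h t) s) * (w t)%:C
     * (g t - h t) = 0 ->
  forall t, (t < N)%N -> g t = h t.
Proof.
move=> s0 S0 t tN.
pose X t := complex.Re ((anglepow (g t) s - anglepow (h t) s) * (g t - h t)).
have X0 u : 0 <= X u by exact: anglepow_strict_mono.
have : \sum_(u < N) w u * X u = 0.
  transitivity (complex.Re (0 : R[i])) => //; rewrite -S0 raddf_sum.
  apply: eq_bigr => u _; rewrite /X -Re_realM; congr complex.Re.
  by rewrite mulrCA mulrA.
move/psumr_eq0P => /(_ (fun u _ => mulr_ge0 (ltW (w_gt0 u)) (X0 u))).
move=> /(_ (Ordinal tN) isT)/eqP; rewrite mulf_eq0 gt_eqF //= eq_sym.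
by rewrite (anglepow_strict_mono _ _ s0) => /eqP.
Qed.
End WeightedNorm.

(** * Degree bounds and orthogonality for the optimal residual *)

Lemma size_mulp_le (R : nzRingType) (f Q : {poly R}) (n d : nat) :
  size f = d.+1 -> (size Q <= n.+1)%N -> (size (Q * f)%R <= (n + d).+1)%N.
Proof.
move=> fd sQ; apply: (leq_trans (size_polyMleq _ _)).
by rewrite fd addnS /= -addSn leq_add2r.
Qed.

Lemma size_residual (R : nzRingType) (f Q : {poly R}) (n d : nat) :
  size f = d.+1 -> (size Q <= n.+1)%N ->
  (size (1 - Q * f)%R <= (n + d).+1)%N.
Proof.
move=> fd sQ; apply: (leq_trans (size_polyD _ _)).
by rewrite size_polyN size_poly1 geq_max /= (size_mulp_le fd).
Qed.

(* The real first-order condition is applied to Q multiplied by the conjugate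
   of the sum: it then says that the squared modulus of the sum is at most 0. *)
Lemma opa_orthogonality (R : realType) (p : R) (w : nat -> R)
    (f P Q : {poly R[i]}) (n d : nat) :
  1 < p -> (forall k, 0 < w k) -> size f = d.+1 ->
  is_opa p w (fun k => f`_k) n P -> (size Q <= n.+1)%N ->
  \sum_(t < (n + d).+1)
    anglepow (1 - P * f)`_t (p - 1) * (w t)%:C * (Q * f)`_t = 0.
Proof.
move=> p1 w0 fd opaP sQ; have p0 : 0 < p := lt_trans ltr01 p1.
have sP : (size P <= n.+1)%N by case: opaP.
set S := \sum_(t < _) _.
pose h t := conjc S * (Q * f)`_t.
have : \sum_(t < (n + d).+1)
    complex.Re (anglepow (1 - P * f)`_t (p - 1) * h t) * w t <= 0.
  apply: minimizer_variation => // e e0.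
  (* The perturbed sequence is the residual of P + e (conj S) Q, an admissible competitor. *)
  have -> : \sum_(t < (n + d).+1) normc ((1 - P * f)`_t - e%:C * h t) `^ p * w t
     = \sum_(t < (n + d).+1)
         normc (1 - (P + (e%:C * conjc S) *: Q) * f)`_t `^ p * w t.
    apply: eq_bigr => t _; rewrite mulrDl opprD addrA [in RHS]coefB.
    by rewrite -scalerAl coefZ mulrA.
  have sQ' : (size (P + (e%:C * conjc S) *: Q)%R <= n.+1)%N.
    apply: (leq_trans (size_polyD _ _)).
    by rewrite geq_max sP (leq_trans (size_scale_leq _ _)).
  rewrite -(lpA_norm_powR_poly w0 p0 (size_residual fd sP)).
  rewrite -(lpA_norm_powR_poly w0 p0 (size_residual fd sQ')).
  apply: ge0_ler_powR; rewrite ?nnegrE ?lpA_norm_ge0 ?(ltW p0) //.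
  exact: is_opa_min opaP sQ'.
have -> : \sum_(t < (n + d).+1)
    complex.Re (anglepow (1 - P * f)`_t (p - 1) * h t) * w t = normc S ^+ 2.
  transitivity (complex.Re (normc S ^+ 2)%:C) => //.
  rewrite -conjc_mul_self /S mulr_sumr raddf_sum; apply: eq_bigr => t _.
  by rewrite mulrC -Re_realM /h; congr complex.Re; ring.
move=> S0; apply/eqP; rewrite -normc_eq0 -sqrf_eq0.
by rewrite eq_le S0 sqr_ge0.
Qed.

(** * Power-sum formula, uniqueness and norm identity *)

Theorem corollary1p1 (R : realType) (p q : R) (w : nat -> R)
    (d : nat) (f : {poly R[i]}) (z : 'I_d -> R[i]) (P : nat -> {poly R[i]})
    (hp : 1 < p) (hq : q = p / (p - 1))
    (hw : admissible_weight w)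
    (hdeg : size f = d.+1)
    (hsimple : forall x : R[i], root f x -> mup x f = 1%N)
    (hzeros : [set x : R[i] | root f x] = range z)
    (hinj : injective z)
    (hcircle : forall i : 'I_d, `|z i| = 1)
    (hP : forall n : nat, is_opa p w (fun k => f`_k) n (P n)) :
  forall n : nat, exists A : 'I_d -> R[i],
    [/\ unique (fun B : 'I_d -> R[i] =>
          forall l : 'I_d,
            1 = \sum_(t < (n + d).+1)
                  anglepow (\sum_(i < d) B i * (z i ^+ t / (w t)%:C)) (q - 1)
                  * z l ^+ t) A,
        forall t : nat, (t <= n + d)%N ->
          anglepow (1 - P n * f)`_t (p - 1) * (w t)%:C
          = \sum_(i < d) A i * z i ^+ t
      & (lpA_norm p w (fun k => (1 - P n * f)`_k) `^ p)%:C
        = \sum_(i < d) A i].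
Proof.
move=> n; have [w0 _ _ _] := hw; have p0 : 0 < p := lt_trans ltr01 hp.
have s0 : 0 < p - 1 by rewrite subr_gt0.
have pq1 : (p - 1) * (q - 1) = 1 by rewrite hq; field; rewrite gt_eqF.
have qp1 : (q - 1) * (p - 1) = 1 by rewrite mulrC.
have q0 : 0 < q - 1 by rewrite -(pmulr_rgt0 _ s0) pq1.
have wC t : (w t)%:C != 0 by rewrite eq_complex /= eqxx andbT gt_eqF.
have fz i : root f (z i).
  by have : [set x | root f x] (z i) by rewrite hzeros; exists i.
have sP : (size (P n) <= n.+1)%N by case: (hP n).
pose g := 1 - P n * f.
have sg : (size g <= (n + d).+1)%N by exact: size_residual.
have gz l : \sum_(t < (n + d).+1) g`_t * z l ^+ t = 1.
  rewrite -horner_coef_wide // /g !hornerE.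
  by move/eqP: (fz l) => ->; rewrite mulr0 subr0.
have [A DA] : exists A : 'I_d -> R[i], forall t, (t <= n + d)%N ->
    anglepow g`_t (p - 1) * (w t)%:C = \sum_(i < d) A i * z i ^+ t.
  apply: (annihilator_power_sums hinj hdeg fz) => k kn.
  by apply: opa_orthogonality => //; rewrite size_polyXn ltnS.
have sumE (B : 'I_d -> R[i]) t :
    \sum_(i < d) B i * (z i ^+ t / (w t)%:C)
    = (\sum_(i < d) B i * z i ^+ t) / (w t)%:C.
  by rewrite mulr_suml; apply: eq_bigr => i _; rewrite mulrA.
exists A; split => //.
- split=> [l|B hB].
    (* Applying <q-1> to D_t / w_t returns g_t, so the l-th equation is g(z_l) = 1. *)
    rewrite -(gz l); apply: eq_bigr => t _.
    by rewrite sumE -DA -1?ltnS // mulfK // (anglepowK _ s0 pq1).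
  pose h t := anglepow (\sum_(i < d) B i * (z i ^+ t / (w t)%:C)) (q - 1).
  have hD t : anglepow (h t) (p - 1) * (w t)%:C = \sum_(i < d) B i * z i ^+ t.
    by rewrite /h (anglepowK _ q0 qp1) sumE mulfVK.
  have gh t : (t < (n + d).+1)%N -> g`_t = h t.
    apply: (anglepow_pairing_inj w0 s0) t.
    (* Exchanging sums leaves the terms (A_i - B_i)(g(z_i) - h(z_i)), where both values are 1. *)
    transitivity (\sum_(t < (n + d).+1) \sum_(i < d)
        (A i - B i) * (g`_t * z i ^+ t - h t * z i ^+ t)).
      apply: eq_bigr => t _; rewrite mulrBl DA -1?ltnS // hD -sumrB mulr_suml.
      by apply: eq_bigr => i _; ring.
    rewrite exchange_big big1 //= => i _.
    by rewrite -mulr_sumr sumrB gz -hB subrr mulr0.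
  apply/funext; apply: (power_sums_inj hinj) => t td.
  have tN : (t <= n + d)%N by rewrite (leq_trans (ltnW td)) ?leq_addl.
  by rewrite -DA // -hD gh.
- rewrite (lpA_norm_powR_poly w0 p0 sg) raddf_sum /=.
  transitivity (\sum_(t < (n + d).+1) \sum_(i < d) A i * (g`_t * z i ^+ t)).
    (* Writing p = (p - 1) + 1 turns |g_t|^p into g_t^<p-1> g_t; the total becomes the sum of the
       A_i g(z_i). *)
    apply: eq_bigr => t _; rewrite realCM -[in LHS](subrK 1 p).
    rewrite -(anglepowM_self _ s0) mulrAC DA -1?ltnS // mulr_suml.
    by apply: eq_bigr => i _; ring.
  rewrite exchange_big /=; apply: eq_bigr => i _.
  by rewrite -mulr_sumr gz mulr1.
Qed.
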